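(* For every $\mathcal{L}_{A_m}^{\Box}$-formula $\varphi$ the following are equivalent: (1) $\varphi$ is $\mathsf{K(A)}$-valid; (2) $\varphi$ is derivable in the axiom system $\mathsf{K(A_m)}$; (3) the sequent $\Rightarrow\varphi$ (empty left-hand side) is derivable in $\mathsf{GK(A_m)}$.
   Context: $\mathcal{L}_{A_m}^{\Box}$-formulas are built from a countably infinite set $\mathrm{Var}$ of variables using binary $\to$ and unary $\Box$. Fix $p_0\in\mathrm{Var}$; $\overline{0}:=p_0\to p_0$, $\neg\varphi:=\varphi\to\overline{0}$, $\varphi\&\psi:=\neg\varphi\to\psi$, $0\varphi:=\overline{0}$, $(n+1)\varphi:=\varphi\&(n\varphi)$. Semantics: a $\mathsf{K(A)}$-model $\langle W,R,V\rangle$ has nonempty $W$, $R\subseteq W\times W$, $V\colon\mathrm{Var}\times W\to[-r,r]$ for some real $r\ge0$, extended by $V(\varphi\to\psi,x)=V(\psi,x)-V(\varphi,x)$, $V(\Box\varphi,x)=\inf_{\mathbb{R}}\{V(\varphi,y):Rxy\}$ (empty infimum $=0$); $\varphi$ is $\mathsf{K(A)}$-valid if $V(\varphi,x)\ge0$ at all worlds of all models. Axiom system $\mathsf{K(A_m)}$: axiom schemas (B) $(\varphi\to\psi)\to((\psi\to\chi)\to(\varphi\to\chi))$; (C) $(\varphi\to(\psi\to\chi))\to(\psi\to(\varphi\to\chi))$; (I) $\varphi\to\varphi$; (A) $((\varphi\to\psi)\to\psi)\to\varphi$; (K) $\Box(\varphi\to\psi)\to(\Box\varphi\to\Box\psi)$;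 (D$_n$) $\Box(n\varphi)\to n\Box\varphi$ ($n\ge2$); rules (mp) $\varphi,\varphi\to\psi/\psi$; (nec) $\varphi/\Box\varphi$; (con$_n$) $n\varphi/\varphi$ ($n\ge2$). Sequent calculus $\mathsf{GK(A_m)}$: sequents $\Gamma\Rightarrow\Delta$ are pairs of finite multisets of formulas; commas = multiset union, $n\Gamma$ = $\Gamma$ repeated $n$ times, $n[\varphi]$ = $n$ copies of $\varphi$, $\Box\Gamma=[\Box\varphi:\varphi\in\Gamma]$. Rules: (id) $\Delta\Rightarrow\Delta$; (cut) from $\Gamma,\varphi\Rightarrow\Delta$ and $\Pi\Rightarrow\varphi,\Sigma$ infer $\Gamma,\Pi\Rightarrow\Sigma,\Delta$; (mix) from $\Gamma\Rightarrow\Delta$ and $\Pi\Rightarrow\Sigma$ infer $\Gamma,\Pi\Rightarrow\Sigma,\Delta$; (sc$_n$) from $n\Gamma\Rightarrow n\Delta$ infer $\Gamma\Rightarrow\Delta$ ($n\ge2$); ($\to\Rightarrow$) from $\Gamma,\psi\Rightarrow\varphi,\Delta$ infer $\Gamma,\varphi\to\psi\Rightarrow\Delta$; ($\Rightarrow\to$) from $\Gamma,\varphi\Rightarrow\psi,\Delta$ infer $\Gamma\Rightarrow\varphi\to\psi,\Delta$; ($\Box_n$) from $\Gamma\Rightarrow n[\varphi]$ infer $\Box\Gamma\Rightarrow n[\Box\varphi]$ ($n\ge0$). A derivation is a finite tree of sequents in which each node with its parents is a rule instance. *)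

(* Defs.v *)
(* reals are Stdlib's R, viewed as a realType via Rstruct;
   infimum is MathComp-Analysis's [inf] (with inf set0 = 0). *)
From HB Require Import structures.
From mathcomp Require Import all_boot all_order all_algebra.
From mathcomp Require Import classical_sets boolp reals Rstruct.
From Stdlib Require Import List Permutation.
Set Implicit Arguments. Unset Strict Implicit. Unset Printing Implicit Defensive.
Import Order.TTheory GRing.Theory Num.Theory.

Inductive form : Type :=
| Var : nat -> form
| Imp : form -> form -> form
| Box : form -> form.

Definition fzero : form := Imp (Var 0) (Var 0).
Definition fneg (a : form) : form := Imp a fzero.
Definition fand (a b : form) : form := Imp (fneg a) b.
Fixpoint ftimes (n : nat) (a : form) : form :=
  match n with
  | O => fzero
  | S n' => fand a (ftimes n' a)
  end.

Section Sem.
Local Open Scope ring_scope.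
Local Open Scope classical_set_scope.

Fixpoint eval (W : Type) (Rel : W -> W -> Prop) (V : nat -> W -> Rdefinitions.R)
    (a : form) (x : W) : Rdefinitions.R :=
  match a with
  | Var p => V p x
  | Imp a b => eval Rel V b x - eval Rel V a x
  | Box a => inf [set eval Rel V a y | y in Rel x]
  end.

(* K(A)-validity: nonnegative at every world of every model
   (W nonempty is implied by quantifying over a world x). *)
Definition KA_valid (a : form) : Prop :=
  forall (W : Type) (Rel : W -> W -> Prop) (V : nat -> W -> Rdefinitions.R)
         (r : Rdefinitions.R),
    0 <= r -> (forall p w, - r <= V p w <= r) ->
    forall x : W, 0 <= eval Rel V a x.
End Sem.

Inductive KAm : form -> Prop :=
| ax_B a b c : KAm (Imp (Imp a b) (Imp (Imp b c) (Imp a c)))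
| ax_C a b c : KAm (Imp (Imp a (Imp b c)) (Imp b (Imp a c)))
| ax_I a : KAm (Imp a a)
| ax_A a b : KAm (Imp (Imp (Imp a b) b) a)
| ax_K a b : KAm (Imp (Box (Imp a b)) (Imp (Box a) (Box b)))
| ax_D n a : (2 <= n)%N -> KAm (Imp (Box (ftimes n a)) (ftimes n (Box a)))
| r_mp a b : KAm a -> KAm (Imp a b) -> KAm b
| r_nec a : KAm a -> KAm (Box a)
| r_con n a : (2 <= n)%N -> KAm (ftimes n a) -> KAm a.

(* Sequent calculus GK(A_m); multisets are lists taken up to permutation. *)
Definition mrep (n : nat) (G : list form) : list form := List.concat (List.repeat G n).

Inductive GKAm : list form -> list form -> Prop :=
| g_perm G G' D D' : GKAm G D -> Permutation G G' -> Permutation D D' -> GKAm G' D'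
| g_id D : GKAm D D
| g_cut G P D S a : GKAm (G ++ a :: nil) D -> GKAm P (a :: S) -> GKAm (G ++ P) (S ++ D)
| g_mix G P D S : GKAm G D -> GKAm P S -> GKAm (G ++ P) (S ++ D)
| g_sc n G D : (2 <= n)%N -> GKAm (mrep n G) (mrep n D) -> GKAm G D
| g_impL G D a b : GKAm (G ++ b :: nil) (a :: D) -> GKAm (G ++ Imp a b :: nil) D
| g_impR G D a b : GKAm (G ++ a :: nil) (b :: D) -> GKAm G (Imp a b :: D)
| g_box n G a : GKAm G (List.repeat a n) -> GKAm (List.map Box G) (List.repeat (Box a) n).

(* Main.v *)
(** A derivable formula is valid because [Box] is an infimum of a bounded set.
    A sequent [G => D] is read in the axiom system as [imps (G ++ map fneg D) fzero],
    and the implicational axioms make formulas up to [feq] an abelian group in which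
    every sequent rule is a group identity or one of (nec), (K), (D_n), (con_n).

    For completeness, consider a finite tree whose nodes are sequences of subformulas
    of [phi], the child [A :: c] of [c] being meant to attain the value of [Box A] at [c].
    Giving integer values to variables and boxed formulas at each node, these
    requirements form a finite system of homogeneous linear inequalities.  A solution
    with [phi] negative at the root is a countermodel.  Otherwise Farkas' lemma over the
    integers writes a positive multiple of [phi] at the root as a sum of constraints.
    Comparing coefficients node by node, from the leaves to the root, such a sum is a
    derivation: the constraints attached to the child [A :: c] form a sequent
    [G => n[A]], to which the rule (Box_n) applies. *)
From HB Require Import structures.
From mathcomp Require Import all_boot all_order all_algebra.
From mathcomp Require Import classical_sets boolp reals Rstruct.
From mathcomp Require Import zify ring lra.
From Stdlib Require Import Setoid Morphisms.
From Stdlib Require List Permutation.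
Require Import Defs.
Set Implicit Arguments. Unset Strict Implicit. Unset Printing Implicit Defensive.
Import Order.TTheory GRing.Theory Num.Theory.

(** * From the sequent calculus to the axiom system *)

Fixpoint form_eqb (a b : form) : bool :=
  match a, b with
  | Var p, Var q => p == q
  | Imp a1 a2, Imp b1 b2 => form_eqb a1 b1 && form_eqb a2 b2
  | Box a1, Box b1 => form_eqb a1 b1
  | _, _ => false
  end.

Lemma form_eqP : Equality.axiom form_eqb.
Proof.
elim=> [p|a IHa b IHb|a IHa] [q|c d|c] /=; try by constructor.
- by apply: (iffP eqP) => [->|[]].
- by apply: (iffP andP) => [[/IHa-> /IHb->]|[<- <-]]; split=> //; [apply/IHa|apply/IHb].
- by apply: (iffP (IHa c)) => [->|[]].
Qed.

HB.instance Definition _ := hasDecEq.Build form form_eqP.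

Lemma Permutation_perm_eq (T : eqType) (s t : seq T) :
  Permutation.Permutation s t -> perm_eq s t.
Proof.
elim=> {s t} [|a s t _ IH|a b s|s t u _ st _ tu] //.
- by rewrite perm_cons.
- by apply/permP => p /=; rewrite addnCA.
- exact: perm_trans tu.
Qed.

Lemma perm_eq_Permutation (T : eqType) (s t : seq T) :
  perm_eq s t -> Permutation.Permutation s t.
Proof.
elim: s t => [|a s IHs] t; first by move/perm_size/esym/size0nil->.
move=> st; have at_ : a \in t by rewrite -(perm_mem st) mem_head.
case/splitPr: at_ st => t1 t2 st.
apply: Permutation.Permutation_cons_app; apply: IHs.
by rewrite -(perm_cons a) (perm_trans st) // perm_catC /= perm_cons perm_catC.
Qed.

(** * Formulas modulo provable equivalence form an abelian group *)

Definition fle (a b : form) : Prop := KAm (Imp a b).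
Definition feq (a b : form) : Prop := fle a b /\ fle b a.

Lemma fle_refl a : fle a a. Proof. exact: ax_I. Qed.

Lemma fle_trans a b c : fle a b -> fle b c -> fle a c.
Proof. by move=> ab bc; apply: (r_mp bc); apply: (r_mp ab); apply: ax_B. Qed.

Lemma fle_exch a b c : fle a (Imp b c) -> fle b (Imp a c).
Proof. by move=> h; apply: (r_mp h); apply: ax_C. Qed.

Lemma fle_impl a b c : fle a b -> fle (Imp b c) (Imp a c).
Proof. by move=> ab; apply: (r_mp ab); apply: ax_B. Qed.

Lemma fle_impr a b c : fle b c -> fle (Imp a b) (Imp a c).
Proof. by move=> bc; apply: (r_mp bc); apply: fle_exch; apply: ax_B. Qed.

Lemma KAm_fle a b : fle a b -> KAm a -> KAm b.
Proof. by move=> ab ka; apply: r_mp ab. Qed.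

#[local] Instance feq_equiv : Equivalence feq.
Proof.
split=> [a|a b []|a b c [ab ba] [bc cb]]; split=> //; try exact: fle_refl.
  exact: fle_trans bc.
exact: fle_trans ba.
Qed.

Lemma feq_refl a : feq a a. Proof. reflexivity. Qed.
#[local] Hint Resolve feq_refl : core.

#[local] Instance Imp_feq : Proper (feq ==> feq ==> feq) Imp.
Proof.
move=> a a' [aa' a'a] b b' [bb' b'b]; split.
  by apply: fle_trans (fle_impr _ bb'); apply: fle_impl.
by apply: fle_trans (fle_impr _ b'b); apply: fle_impl.
Qed.

#[local] Instance KAm_feq : Proper (feq ==> iff) KAm.
Proof. by move=> a b [ab ba]; split; apply: KAm_fle. Qed.

Lemma feq_exch a b c : feq (Imp a (Imp b c)) (Imp b (Imp a c)).
Proof. by split; apply: ax_C. Qed.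

Lemma feq_dneg a b : feq (Imp (Imp a b) b) a.
Proof. by split; [apply: ax_A | apply: fle_exch; apply: fle_refl]. Qed.

(** There is no weakening axiom, so this needs (A): write [b] as [(b -> a) -> a], expand the last
    [a] to [(a -> a) -> a], exchange, and contract again. It makes all formulas [a -> a] equivalent,
    which gives the group its zero. *)
Lemma fle_unit a b : fle b (Imp (Imp a a) b).
Proof.
have h : fle a (Imp (Imp a a) a) by apply: fle_exch; apply: fle_refl.
have [_ h1] := feq_dneg b a; apply: (fle_trans h1).
apply: fle_trans (fle_impr _ h) _; apply: fle_trans (ax_C _ _ _) _.
by apply: fle_impr; apply: ax_A.
Qed.

Lemma feq_self a b : feq (Imp a a) (Imp b b).
Proof. by split; apply: fle_exch; apply: fle_unit. Qed.

Lemma feq_zero a : feq (Imp a a) fzero. Proof. exact: feq_self. Qed.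

Lemma feq_imp0l a : feq (Imp fzero a) a.
Proof. by rewrite -(feq_zero a); apply: feq_dneg. Qed.

Lemma feq_neg_imp a b : feq (fneg (Imp a b)) (Imp b a).
Proof. by rewrite -{2}(feq_dneg a b) feq_exch /fneg feq_zero. Qed.

Lemma feq_imp_cancel a b c : feq (Imp (Imp a b) (Imp a c)) (Imp b c).
Proof.
rewrite -{1}(feq_dneg c b) (feq_exch a) (feq_exch (Imp a b)) feq_zero.
exact: feq_neg_imp.
Qed.

(** A premise and its negation cancel: this handles (id) and removes the cut formula in (cut). *)
Lemma feq_pair a b : feq (Imp a (Imp (fneg a) b)) b.
Proof. by rewrite feq_exch /fneg feq_imp_cancel feq_imp0l. Qed.

Lemma feq_impL a b c : feq (Imp (Imp a b) c) (Imp b (Imp (fneg a) c)).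
Proof. by rewrite -{1}(feq_pair a c) feq_imp_cancel. Qed.

Lemma feq_impR a b c : feq (Imp (fneg (Imp a b)) c) (Imp a (Imp (fneg b) c)).
Proof. by rewrite feq_neg_imp feq_impL. Qed.

Lemma KAm_fzero_le a : KAm a -> fle fzero a.
Proof. by move=> ka; rewrite /fle feq_imp0l. Qed.

(** * Sequents as iterated implications *)

Definition imps (L : seq form) (c : form) : form := foldr Imp c L.

Lemma imps_cat L M c : imps (L ++ M) c = imps L (imps M c).
Proof. exact: foldr_cat. Qed.

Lemma fle_imps L b c : fle b c -> fle (imps L b) (imps L c).
Proof. by move=> bc; elim: L => [|a L IH] //=; apply: fle_impr. Qed.

#[local] Instance imps_feq L : Proper (feq ==> feq) (imps L).
Proof. by move=> b c [bc cb]; split; apply: fle_imps. Qed.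

Lemma imps_perm L M c : perm_eq L M -> feq (imps L c) (imps M c).
Proof.
move/perm_eq_Permutation; elim=> {L M} [|a L M _ IH|a b L|L M N _ LM _ MN] /=.
- reflexivity.
- by rewrite IH.
- exact: feq_exch.
- by rewrite LM.
Qed.

(** In the group [imps L c] is [c] minus the sum of [L], so [fneg (imps L fzero)] is that sum,
    packed into one premise. *)
Lemma imps_neg L c : feq (Imp (fneg (imps L fzero)) c) (imps L c).
Proof.
elim: L => [|a L IH] /=; last by rewrite feq_impR IH.
by rewrite /fneg !feq_imp0l.
Qed.

Lemma imps_mrep n L : feq (imps (mrep n L) fzero) (ftimes n (imps L fzero)).
Proof.
elim: n => [|n IH] /=; first reflexivity.
have -> : mrep n.+1 L = L ++ mrep n L by [].
by rewrite imps_cat /fand -IH imps_neg.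
Qed.

Lemma imps_repeat_neg n a : imps (List.repeat (fneg a) n) fzero = ftimes n a.
Proof. by elim: n => [|n IH] //=; rewrite IH. Qed.

Lemma fle_box a b : fle a b -> fle (Box a) (Box b).
Proof. by move=> ab; apply: (r_mp (r_nec ab)); apply: ax_K. Qed.

Lemma fle_box_imps G c : fle (Box (imps G c)) (imps (map Box G) (Box c)).
Proof.
elim: G => [|a G IH] /=; first exact: fle_refl.
by apply: fle_trans (ax_K _ _) _; apply: fle_impr.
Qed.

(** Axiom (D_n) covers [n >= 2]; [n = 0] comes from (K) since [fzero] is an implication, and [n = 1]
    is double negation. *)
Lemma fle_box_ftimes n a : fle (Box (ftimes n a)) (ftimes n (Box a)).
Proof.
case: n => [|[|n]]; last exact: ax_D.
- by apply: fle_trans (ax_K _ _) _; case: (feq_zero (Box (Var 0))).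
- apply: fle_trans (proj2 (feq_dneg (Box a) fzero)).
  by apply: fle_box; case: (feq_dneg a fzero).
Qed.

Definition fseq (G D : seq form) : form := imps (G ++ map fneg D) fzero.

Lemma KAm_fseq_perm G D G' D' :
  perm_eq (G ++ map fneg D) (G' ++ map fneg D') -> KAm (fseq G D) -> KAm (fseq G' D').
Proof. by move=> h; rewrite /fseq (imps_perm _ h). Qed.

Lemma KAm_imps_cancel L a : KAm (imps (a :: fneg a :: L) fzero) -> KAm (imps L fzero).
Proof. by rewrite /= feq_pair. Qed.

Lemma KAm_imps_cat L M : KAm (imps L fzero) -> KAm (imps M fzero) ->
  KAm (imps (L ++ M) fzero).
Proof.
by move=> kL kM; rewrite imps_cat; apply: KAm_fle kL; apply/fle_imps/KAm_fzero_le.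
Qed.

Ltac permc := apply/permP => ?; rewrite ?map_cat /= ?count_cat /= ?map_cat /= ?count_cat /=; lia.

Lemma KAm_imps_perm L M : perm_eq L M -> KAm (imps L fzero) -> KAm (imps M fzero).
Proof. by move=> h; rewrite (imps_perm _ h). Qed.

Lemma count_mrep p n (L : seq form) : count p (mrep n L) = n * count p L.
Proof.
elim: n => //= n IH; have -> : mrep n.+1 L = L ++ mrep n L by [].
by rewrite count_cat IH mulSn.
Qed.

Lemma GKAm_KAm G D : GKAm G D -> KAm (fseq G D).
Proof.
elim=> {G D}.
- move=> G G' D D' _ IH /Permutation_perm_eq GG' /Permutation_perm_eq DD'.
  by apply: KAm_fseq_perm IH; apply: perm_cat => //; apply: perm_map.
- elim=> [|a D IH]; first exact: ax_I.
  rewrite /fseq (imps_perm (M := a :: fneg a :: (D ++ map fneg D))); last by permc.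
  by rewrite /= feq_pair.
- move=> G P D S a _ IH1 _ IH2; apply: (@KAm_imps_cancel _ a).
  by apply: KAm_imps_perm (KAm_imps_cat IH1 IH2); permc.
- move=> G P D S _ IH1 _ IH2.
  by apply: KAm_imps_perm (KAm_imps_cat IH1 IH2); permc.
- move=> n G D n2 _ IH; apply: (r_con n2); rewrite -imps_mrep.
  apply: KAm_imps_perm IH; apply/permP => p.
  by rewrite !count_cat !count_map !count_mrep count_cat count_map mulnDr.
- move=> G D a b _ IH; apply: (KAm_imps_perm (L := Imp a b :: (G ++ map fneg D))).
    by permc.
  rewrite /= feq_impL.
  by apply: (KAm_imps_perm (M := b :: fneg a :: (G ++ map fneg D))) IH; permc.
- move=> G D a b _ IH; apply: (KAm_imps_perm (L := fneg (Imp a b) :: (G ++ map fneg D))).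
    by permc.
  rewrite /= feq_impR.
  by apply: (KAm_imps_perm (M := a :: fneg b :: (G ++ map fneg D))) IH; permc.
- move=> n G a _.
  have map_rep (f : form -> form) b m : map f (List.repeat b m) = List.repeat (f b) m.
    by elim: m => //= m ->.
  rewrite /fseq !map_rep !imps_cat !imps_repeat_neg => /r_nec.
  apply: KAm_fle; apply: fle_trans (fle_box_imps _ _) _.
  by apply: fle_imps; apply: fle_box_ftimes.
Qed.

Lemma GKAm_nil_KAm a : GKAm nil (a :: nil) -> KAm a.
Proof. by move/GKAm_KAm; rewrite /fseq /= feq_dneg. Qed.

(** * Soundness *)

Section Soundness.
Local Open Scope ring_scope.
Local Open Scope classical_set_scope.
Local Notation R := Rdefinitions.R.

Lemma inf_image_le (T : Type) (D : set T) (f : T -> R) (m : R) y :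
  (forall z, m <= f z) -> D y -> inf [set f z | z in D] <= f y.
Proof.
move=> mf Dy; apply: ge_inf; last by exists y.
by exists m => _ [z _ <-].
Qed.

Lemma le_inf_image (T : Type) (D : set T) (f : T -> R) m :
  D !=set0 -> (forall y, D y -> m <= f y) -> m <= inf [set f z | z in D].
Proof.
move=> [y Dy] mf; apply: lb_le_inf; first by exists (f y), y.
by move=> _ [z Dz <-]; apply: mf.
Qed.

Lemma inf_image_empty (T : Type) (D : set T) (f : T -> R) :
  ~ (D !=set0) -> inf [set f z | z in D] = 0.
Proof. by move=> /nonemptyPn->; rewrite image_set0 inf0. Qed.

Variables (W : Type) (Rel : W -> W -> Prop) (V : nat -> W -> R) (r : R).
Hypothesis (Vr : forall p w, - r <= V p w <= r).
Local Notation ev := (eval Rel V).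

Lemma eval_bounded a : exists M, forall w, - M <= ev a w <= M.
Proof.
elim: a => [p|a [M aM] b [N bN]|a [M aM]] /=; first by exists r.
  by exists (M + N) => w; move: (aM w) (bN w); lra.
exists M => w; have [[y wy]|w0] := pselect (Rel w !=set0).
  have m z : - M <= ev a z by case/andP: (aM z).
  rewrite (le_inf_image (m := - M)) //; last by exists y.
  by rewrite (le_trans (inf_image_le m wy)) //; case/andP: (aM y).
by rewrite inf_image_empty //; move: (aM w); lra.
Qed.

Lemma eval_lb a : exists m, forall w, m <= ev a w.
Proof. by have [M h] := eval_bounded a; exists (- M) => w; case/andP: (h w). Qed.

Lemma eval_ftimes n a w : ev (ftimes n a) w = ev a w *+ n.
Proof.
elim: n => [|n IH]; first by rewrite /= subrr.
by rewrite mulrS -IH /=; lra.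
Qed.

Lemma KAm_eval_ge0 a : KAm a -> forall w, 0 <= ev a w.
Proof.
elim=> {a}.
- by move=> a b c w /=; lra.
- by move=> a b c w /=; lra.
- by move=> a w /=; lra.
- by move=> a b w /=; lra.
- move=> a b w; have [m am] := eval_lb a; have [n abn] := eval_lb (Imp a b).
  (* At a world without successors every box has value 0. *)
  have [w0|w0] := pselect (Rel w !=set0); last by rewrite /= !inf_image_empty // !subr0.
  rewrite /= !subr_ge0 lerBrDl; apply: le_inf_image => // y wy.
  have h1 := inf_image_le am wy; have h2 := inf_image_le abn wy.
  by move: h1 h2 => /=; lra.
- move=> n a n2 w; have [m am] := eval_lb (ftimes n a).
  rewrite [ev _ _]/= subr_ge0 eval_ftimes /=.
  have [w0|w0] := pselect (Rel w !=set0); last by rewrite !inf_image_empty // mul0rn.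
  have n0 : 0 < n%:R :> R by rewrite ltr0n; apply: leq_trans n2.
  rewrite -mulr_natr -ler_pdivrMr //; apply: le_inf_image => // y wy.
  rewrite ler_pdivrMr // mulr_natr -eval_ftimes; exact: inf_image_le am wy.
- by move=> a b _ IHa _ IHb w; move: (IHa w) (IHb w) => /=; lra.
- move=> a _ IH w /=; have [w0|w0] := pselect (Rel w !=set0).
    exact: le_inf_image.
  by rewrite inf_image_empty.
- move=> n a n2 _ IH w; move: (IH w); rewrite eval_ftimes pmulrn_lge0 //.
  exact: leq_trans n2.
Qed.

End Soundness.

Lemma KAm_valid a : KAm a -> KA_valid a.
Proof. by move=> ka W Rel V r _ Vr x; exact: (KAm_eval_ge0 Rel Vr ka x). Qed.

(** * Farkas' lemma over the integers *)

Section Farkas.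
Local Open Scope ring_scope.
Variables (I : Type) (T : eqType).

Definition int_linear (f : (I -> int) -> int) : Prop :=
  forall s t x y, f (fun i => s * x i + t * y i) = s * f x + t * f y.

Lemma sum_nseq_abs (t : T) (f : T -> int) (c : int) : 0 <= c ->
  \sum_(u <- nseq `|c|%N t) f u = c * f t.
Proof.
move=> c0; rewrite big_nseq; case: c c0 => // n _ /=.
by elim: n => [|n IH] /=; rewrite ?mul0r // IH intS mulrDl mul1r.
Qed.

(* Bartl's induction: if the head constraint [g t] is needed, a point [x0]
   violating it allows one to project all the functionals along [x0]
   into the hyperplane [g t = 0]. *)
Lemma farkas_int (ts : seq T) (g : T -> (I -> int) -> int) (b : (I -> int) -> int) :
  (forall t, int_linear (g t)) -> int_linear b ->
  (forall x, (forall t, t \in ts -> 0 <= g t x) -> 0 <= b x) ->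
  exists (k : nat) (us : seq T), [/\ (0 < k)%N, {subset us <= ts} &
    forall x, k%:Z * b x = \sum_(u <- us) g u x].
Proof.
elim: ts g b => [|t ts IH] g b glin blin gb.
  exists 1%N, [::]; split=> // x; rewrite big_nil mul1r.
  have h1 : 0 <= b x by apply: gb.
  (* Without constraints [b] is nonnegative at [x] and at [-x], hence zero. *)
  have : 0 <= b (fun i => (-1) * x i + 0 * x i) by apply: gb.
  by rewrite blin; lia.
have [h|] := pselect (forall x, (forall t, t \in ts -> 0 <= g t x) -> 0 <= b x).
  have [k [us [k0 sus e]]] := IH g b glin blin h.
  by exists k, us; split=> // u /sus uts; rewrite inE uts orbT.
move=> /existsNP [x0 /not_implyP [x0ts /negP]]; rewrite -ltNge => bx0.
have gx0 : g t x0 < 0.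
  rewrite ltNge; apply/negP => gt0; move: bx0; rewrite ltNge => /negP; apply.
  by apply: gb => u; rewrite inE => /orP[/eqP->|/x0ts].
(* The projection along [x0] with denominators cleared: [g t] vanishes at [y x], and the factor
   [- g t x0] is positive. *)
pose y x i := - g t x0 * x i + g t x * x0 i.
have ylin f : int_linear f -> int_linear (fun x => f (y x)).
  by move=> flin s s' x x'; rewrite /y !flin glin; ring.
have [|||k [us [k0 sus e]]] := IH (fun u x => g u (y x)) (fun x => b (y x)).
- by move=> u; apply: ylin.
- exact: ylin.
- move=> x xts; apply: gb => u; rewrite inE => /orP[/eqP->|/xts //].
  by rewrite glin; lia.
(* Expanding the identity at [y x] leaves exactly [c] as the coefficient of [g t x], while the other
   terms are scaled by [- g t x0]. *)
pose c := \sum_(u <- us) g u x0 - k%:Z * b x0.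
have c0 : 0 <= c.
  rewrite subr_ge0 (@le_trans _ _ 0) //; last first.
    by rewrite big_seq; apply: sumr_ge0 => u /sus; apply: x0ts.
  by rewrite pmulr_rle0 ?ltW.
pose s := - g t x0; have s0 : 0 < s by rewrite oppr_gt0.
exists (k * `|s|)%N, (flatten [seq nseq `|s|%N u | u <- us] ++ nseq `|c|%N t).
split.
- by rewrite muln_gt0 k0 absz_gt0 gt_eqF.
- move=> u; rewrite mem_cat inE => /orP[/flatten_mapP[v /sus vts]|].
    by rewrite mem_nseq => /andP[_ /eqP->]; rewrite vts orbT.
  by rewrite mem_nseq => /andP[_ ->].
move=> x; rewrite big_cat big_flatten big_map sum_nseq_abs //=.
under eq_bigr do rewrite (sum_nseq_abs _ (fun u => g u x) (ltW s0)).
have gy : \sum_(u <- us) g u (y x) = s * \sum_(u <- us) g u x + g t x * \sum_(u <- us) g u x0.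
  by rewrite !mulr_sumr -big_split; apply: eq_bigr => u _; rewrite glin.
have := e x; rewrite gy blin -/s -!mulr_sumr PoszM gtz0_abs // /c.
by set A := \sum_(u <- us) g u x; set B := \sum_(u <- us) _; nia.
Qed.
End Farkas.
(** * Derivations from Farkas certificates *)

Section Atoms.
Local Open Scope ring_scope.

(* Every formula is an integer combination of variables and boxed formulas;
   [fev] treats the latter as atoms with arbitrary values. *)
Fixpoint fev (v : form -> int) (a : form) : int :=
  match a with
  | Imp b c => fev v c - fev v b
  | _ => v a
  end.

Fixpoint atoms (s : bool) (a : form) : seq form :=
  match a with
  | Imp b c => atoms s c ++ atoms (~~ s) b
  | _ => if s then [:: a] else [::]
  end.

Lemma fev_atoms v a :
  fev v a = \sum_(f <- atoms true a) v f - \sum_(f <- atoms false a) v f.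
Proof.
elim: a => [p|b IHb c IHc|b _] /=; rewrite ?big_seq1 ?big_nil ?subr0 //.
by rewrite IHb IHc !big_cat /=; ring.
Qed.

Definition atomss (s : bool) (G : seq form) : seq form := flatten (map (atoms s) G).

Lemma sum_fev_atomss v G :
  \sum_(a <- G) fev v a = \sum_(f <- atomss true G) v f - \sum_(f <- atomss false G) v f.
Proof.
rewrite !big_flatten !big_map -sumrB; apply: eq_bigr => a _; exact: fev_atoms.
Qed.

Lemma GKAm_perm_eq G G' D D' :
  GKAm G D -> perm_eq G G' -> perm_eq D D' -> GKAm G' D'.
Proof. by move=> h /perm_eq_Permutation ? /perm_eq_Permutation; apply: g_perm h _. Qed.

Lemma GKAm_mix G P D S : GKAm G D -> GKAm P S -> GKAm (G ++ P) (D ++ S).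
Proof. by move=> h1 h2; apply: GKAm_perm_eq (g_mix h1 h2) _ _; permc. Qed.

(** Turn the two copies into [a -> a] on the right and cut against [a -> a =>], which follows from
    (id). *)
Lemma GKAm_cancel1 G D a : GKAm (G ++ [:: a]) (a :: D) -> GKAm G D.
Proof.
move=> /g_impR h; have := g_cut (g_impL (G := [::]) (g_id [:: a])) h.
by move=> h2; apply: GKAm_perm_eq h2 _ _; permc.
Qed.

Lemma GKAm_cancel G D X : GKAm (G ++ X) (X ++ D) -> GKAm G D.
Proof.
elim: X G D => [|a X IH] G D h; first by rewrite cats0 in h.
apply: IH; apply: (@GKAm_cancel1 _ _ a).
by apply: GKAm_perm_eq h _ _; permc.
Qed.

Lemma GKAm_atoms a G D :
  (GKAm (G ++ atoms true a) (atoms false a ++ D) -> GKAm (G ++ [:: a]) D) /\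
  (GKAm (G ++ atoms false a) (atoms true a ++ D) -> GKAm G (a :: D)).
Proof.
elim: a G D => [p|b IHb c IHc|b _] G D /=; try by rewrite cats0.
split=> h.
  apply: g_impL; apply: (IHb _ _).2.
  apply: (@GKAm_perm_eq ((G ++ atoms false b) ++ [:: c]) _ (atoms true b ++ D));
    [|permc|by []].
  by apply: (IHc _ _).1; apply: GKAm_perm_eq h _ _; permc.
apply: g_impR; apply: (IHb _ _).1.
apply: (@GKAm_perm_eq (G ++ atoms true b) _ (c :: atoms false b ++ D)); [|by []|permc].
by apply: (IHc _ _).2; apply: GKAm_perm_eq h _ _; permc.
Qed.

Lemma GKAm_atomssL X G D :
  GKAm (G ++ atomss true X) (atomss false X ++ D) -> GKAm (G ++ X) D.
Proof.
elim: X G D => [|a X IH] G D //=; rewrite /atomss /= => h.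
apply: (@GKAm_perm_eq ((G ++ X) ++ [:: a]) _ D); [|permc|by []].
apply: (GKAm_atoms _ _ _).1.
apply: (@GKAm_perm_eq ((G ++ atoms true a) ++ X) _ (atoms false a ++ D)); [|permc|by []].
by apply: IH; apply: GKAm_perm_eq h _ _; rewrite /atomss; permc.
Qed.

Lemma GKAm_atomssR X G D :
  GKAm (G ++ atomss false X) (atomss true X ++ D) -> GKAm G (X ++ D).
Proof.
elim: X G D => [|a X IH] G D //=; rewrite /atomss /= => h.
  by rewrite cats0 in h.
apply: (GKAm_atoms _ _ _).2.
apply: (@GKAm_perm_eq (G ++ atoms false a) _ (X ++ (atoms true a ++ D))); [|by []|permc].
by apply: IH; apply: GKAm_perm_eq h _ _; rewrite /atomss; permc.
Qed.

(** The implication rules, read upwards, reduce both sides to atoms. Testing with the indicator of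
    each atom shows that the resulting multisets agree, so (id) closes the derivation. *)
Lemma GKAm_of_fev_eq G D :
  (forall v, \sum_(a <- G) fev v a = \sum_(a <- D) fev v a) -> GKAm G D.
Proof.
move=> GD; rewrite -[D]cats0; apply: GKAm_atomssR.
apply: (@GKAm_perm_eq (atomss false D ++ G) _ (atomss true D ++ [::])); [|permc|by []].
apply: GKAm_atomssL; apply: GKAm_perm_eq (g_id _) (perm_refl _) _.
apply/allP => f _; apply/eqP.
have sumE (s : seq form) : \sum_(a <- s) (a == f)%:Z = (count_mem f s)%:Z.
  elim: s => [|a s IH] /=; first by rewrite big_nil.
  by rewrite big_cons IH PoszD.
have := GD (fun a => (a == f)%:Z); rewrite !sum_fev_atomss !sumE !count_cat /=.
lia.
Qed.

End Atoms.

(** * Linear constraints on the tree of sequences *)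

Section Certificate.
Local Open Scope ring_scope.

(* A label [(A, c, Some B)] stands for the inequality [x_c(Box B) <= x_{A :: c}(B)]
   between a node [c] and its child [A :: c] of the tree of finite sequences of formulas,
   and [(A, c, None)] for [x_{A :: c}(A) <= x_c(Box A)]: the child [A :: c] is
   where [Box A] is attained. *)
Definition label : Type := (form * seq form * option form)%type.
HB.instance Definition _ := Equality.on label.

Definition lpath (t : label) : seq form := t.1.1 :: t.1.2.
Definition lparent (t : label) : seq form := t.1.2.
Definition lpos (t : label) : bool := isSome t.2.
Definition lform (t : label) : form := odflt t.1.1 t.2.

Definition node (x : seq form * form -> int) (c : seq form) : form -> int :=
  fun f => x (c, f).

Definition constr (t : label) (x : seq form * form -> int) : int :=
  (-1) ^+ (~~ lpos t) * (fev (node x (lpath t)) (lform t) - x (lparent t, Box (lform t))).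

Lemma fev_lin a s t u v :
  fev (fun f => s * u f + t * v f) a = s * fev u a + t * fev v a.
Proof. by elim: a => [p|b IHb c IHc|b _] //=; rewrite IHb IHc; lia. Qed.

Lemma fev_node_linear a c : int_linear (fun x => fev (node x c) a).
Proof. by move=> s t x y; apply: fev_lin. Qed.

Lemma constr_linear t : int_linear (constr t).
Proof.
move=> s s' x y; rewrite /constr.
rewrite (fev_node_linear (lform t) (lpath t) s s' x y).
by ring.
Qed.

Definition lforms (s : bool) (us : seq label) : seq form :=
  [seq lform t | t <- us & lpos t == s].

Lemma lforms_cat s us ws : lforms s (us ++ ws) = lforms s us ++ lforms s ws.
Proof. by rewrite /lforms filter_cat map_cat. Qed.

(** Substituting this point into a Farkas identity isolates its coefficients at the node [c]. *)
Definition at_node (c : seq form) (v : form -> int) (i : seq form * form) : int :=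
  if i.1 == c then v i.2 else 0.

Lemma fev_at_node c d v a :
  fev (node (at_node c v) d) a = if d == c then fev v a else 0.
Proof.
elim: a => [p|b IHb e IHe|b _] //=; rewrite IHb IHe.
by case: ifP; rewrite ?subr0.
Qed.

Lemma sum_constr_at_node us c v :
  \sum_(t <- us) constr t (at_node c v) =
    \sum_(a <- lforms true [seq t <- us | lpath t == c]) fev v a -
    \sum_(a <- lforms false [seq t <- us | lpath t == c]) fev v a -
    \sum_(a <- map Box (lforms true [seq t <- us | lparent t == c])) fev v a +
    \sum_(a <- map Box (lforms false [seq t <- us | lparent t == c])) fev v a.
Proof.
elim: us => [|t us IH]; first by rewrite /= !big_nil.
rewrite big_cons IH /constr fev_at_node /at_node /=.
by do 2![case: ifP => _ /=]; rewrite /lforms /=; case: (lpos t); rewrite /= ?big_cons /=; lia.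
Qed.

(** Induction on the number of labels: those sharing the path of the first one are split off and
    joined to the rest by (mix). *)
Lemma GKAm_group ws :
  (forall d, GKAm (map Box (lforms true [seq t <- ws | lpath t == d]))
                  (map Box (lforms false [seq t <- ws | lpath t == d]))) ->
  GKAm (map Box (lforms true ws)) (map Box (lforms false ws)).
Proof.
have [n] := ubnP (size ws); elim: n ws => // n IH [|t ws] sz h; first exact: g_id.
pose q (u : label) := lpath u == lpath t.
have h2 : GKAm (map Box (lforms true [seq u <- t :: ws | ~~ q u]))
    (map Box (lforms false [seq u <- t :: ws | ~~ q u])).
  apply: IH => [|d].
    rewrite /= /q eqxx /= size_filter.
    by have := count_size (fun u => lpath u != lpath t) ws; move: sz => /=; lia.
  have [->|nd] := eqVneq d (lpath t).
    rewrite -filter_predI (eq_filter (a2 := pred0)) ?filter_pred0; first exact: g_id.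
    by move=> u /=; rewrite /q; case: eqP.
  rewrite -filter_predI (eq_filter (a2 := fun u => lpath u == d)) //.
  by move=> u /=; rewrite /q; case: eqP => // ->; rewrite nd.
have pe s : perm_eq (map Box (lforms s (filter q (t :: ws))) ++
      map Box (lforms s (filter (fun u => ~~ q u) (t :: ws))))
    (map Box (lforms s (t :: ws))).
  by rewrite -map_cat -lforms_cat; do 2!apply: perm_map; apply: perm_filter;
    rewrite perm_filterC.
exact: GKAm_perm_eq (GKAm_mix (h (lpath t)) h2) (pe true) (pe false).
Qed.

(** * Reading a derivation off the certificate *)

Section ReadOff.
Variables (us : seq label) (k : nat) (phi : form).
Hypothesis cert : forall x,
  k%:Z * fev (node x [::]) phi = \sum_(t <- us) constr t x.

Local Notation below s c := (lforms s [seq t <- us | lpath t == c]).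
Local Notation boxed s c := (map Box (lforms s [seq t <- us | lparent t == c])).

Lemma GKAm_boxed c :
  (forall A, GKAm (below true (A :: c)) (below false (A :: c))) ->
  GKAm (boxed true c) (boxed false c).
Proof.
move=> h; apply: GKAm_group => d.
have [[A ->]|nd] := pselect (exists A, d = A :: c); last first.
  rewrite -filter_predI (eq_filter (a2 := pred0)) ?filter_pred0; first exact: g_id.
  by move=> t /=; apply/negP => /andP[/eqP td /eqP tc]; apply: nd; exists t.1.1; rewrite -td -tc.
rewrite -filter_predI (eq_filter (a2 := fun t => lpath t == A :: c)); last first.
  by move=> t /=; rewrite /lpath eqseq_cons; case: eqP; case: eqP.
(* A negative label at the child [A :: c] can only carry [A], so the right side has the shape
   required by (Box_n). *)
have e : exists n, below false (A :: c) = List.repeat A n.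
  elim: (us) => [|[[B d'] [C|]] ws [n IH]] /=; first by exists 0%N.
    by case: ifP => _ /=; exists n.
  case: ifP => [/eqP[-> _]|_]; last by exists n.
  by exists n.+1; rewrite /lforms /= -/(lforms _ _) IH.
have [n en] := e; move: (h A); rewrite en => /g_box.
by have -> : map Box (List.repeat A n) = List.repeat (Box A) n by elim: (n) => //= m ->.
Qed.

(** Induction from the leaves, with [m] bounding the remaining height. Since [phi] sits at the root,
    the coefficients at [A :: c] sum to zero; this balances the formulas below against the boxed
    ones, which the sequents of the children then cancel. *)
Lemma GKAm_below m A c :
  (forall t, t \in us -> (size (lpath t) < size (A :: c) + m)%N) ->
  GKAm (below true (A :: c)) (below false (A :: c)).
Proof.
elim: m A c => [|m IH] A c h.
  rewrite (eq_in_filter (a2 := pred0)) ?filter_pred0; first exact: g_id.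
  by move=> t /h; case: eqP => // ->; rewrite addn0 ltnn.
have hb : GKAm (boxed true (A :: c)) (boxed false (A :: c)).
  by apply: GKAm_boxed => B; apply: IH => t /h; rewrite /=; lia.
apply: (@GKAm_cancel _ _ (boxed true (A :: c) ++ boxed false (A :: c))).
have hid : GKAm (below true (A :: c) ++ boxed false (A :: c))
    (below false (A :: c) ++ boxed true (A :: c)).
  apply: GKAm_of_fev_eq => v; have := cert (at_node (A :: c) v).
  rewrite fev_at_node sum_constr_at_node !big_cat /= mulr0.
  have aux (p n q r : int) : 0 = p - n - q + r -> p + r = n + q by lia.
  exact: aux.
by apply: GKAm_perm_eq (GKAm_mix hid hb) _ _; permc.
Qed.

Lemma GKAm_certificate : GKAm [::] (nseq k phi).
Proof.
have hb : GKAm (boxed true [::]) (boxed false [::]).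
  apply: GKAm_boxed => A; apply: (@GKAm_below (\max_(t <- us) size (lpath t))).
  by move=> t tus; apply: (leq_bigmax_seq (F := fun t => size (lpath t))).
apply: (@GKAm_cancel _ _ (boxed true [::] ++ boxed false [::])).
have hid : GKAm (boxed false [::]) (nseq k phi ++ boxed true [::]).
  apply: GKAm_of_fev_eq => v; have := cert (at_node [::] v).
  (* Every [lpath] is nonempty, so only the boxed terms survive at the root. *)
  rewrite fev_at_node sum_constr_at_node !big_cat /= (eq_filter (a2 := pred0)) //.
  rewrite filter_pred0 /lforms /= !big_nil -/(lforms _ _) -/(lforms _ _).
  have -> : \sum_(a <- nseq k phi) fev v a = k%:Z * fev v phi.
    elim: (k) => [|n IH] /=; first by rewrite big_nil mul0r.
    by rewrite big_cons IH intS mulrDl mul1r.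
  have aux (l q r : int) : l = 0 - 0 - q + r -> r = l + q by lia.
  exact: aux.
by apply: GKAm_perm_eq (GKAm_mix hid hb) _ _; permc.
Qed.

End ReadOff.
End Certificate.

(** * Countermodels and completeness *)

Fixpoint subs (a : form) : seq form :=
  a :: match a with
       | Var _ => [::]
       | Imp b c => subs b ++ subs c
       | Box b => subs b
       end.

Fixpoint mdepth (a : form) : nat :=
  match a with
  | Var _ => 0
  | Imp b c => maxn (mdepth b) (mdepth c)
  | Box b => (mdepth b).+1
  end.

Lemma mem_subs a : a \in subs a.
Proof. by case: a => *; rewrite /= mem_head. Qed.

Lemma subs_trans a b : a \in subs b -> {subset subs a <= subs b}.
Proof.
elim: b => [p|b IHb c IHc|b IHb]; first by rewrite mem_seq1 => /eqP->.
all: rewrite /= inE => /predU1P[->//|].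
  by rewrite mem_cat => /orP[/IHb h|/IHc h] d /h dh; rewrite inE mem_cat dh ?orbT.
by move=> /IHb h d /h dh; rewrite inE dh orbT.
Qed.

Fixpoint paths (S : seq form) (n : nat) : seq (seq form) :=
  if n is n'.+1 then [::] :: [seq A :: c | A <- S, c <- paths S n'] else [:: [::]].

Lemma mem_paths S n c : all [in S] c -> size c <= n -> c \in paths S n.
Proof.
elim: n c => [|n IH] [|A c] //= /andP[AS cS] sc.
by rewrite inE /=; apply: allpairs_f => //; apply: IH.
Qed.

Section Countermodel.
Local Open Scope ring_scope.
Local Open Scope classical_set_scope.
Local Notation R := Rdefinitions.R.

Lemma inf_image_min (T : Type) (D : set T) (f : T -> R) y :
  D y -> (forall z, D z -> f y <= f z) -> inf [set f z | z in D] = f y.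
Proof.
move=> Dy fy; apply/eqP; rewrite eq_le; apply/andP; split.
  apply: ge_inf; last by exists y.
  by exists (f y) => _ [z Dz <-]; apply: fy.
by apply: le_inf_image => //; exists y.
Qed.

Variables (phi : form) (x : seq form * form -> int).
Local Notation S := (subs phi).
Local Notation D := (mdepth phi).

Definition labels : seq label :=
  [seq (i, o) | i <- [seq (A, c) | A <- S, c <- paths S D], o <- None :: map Some S].

Hypothesis xS : forall t, t \in labels -> 0 <= constr t x.

(** Since [phi] lies in [S], every node has a successor and no box takes the default value of an
    empty infimum. *)
Definition cm_rel (c d : seq form) : Prop := exists2 A, A \in S & d = A :: c.

(* Cut off outside finitely many nodes and variables to make the valuation bounded. *)
Definition cm_val (p : nat) (c : seq form) : R :=
  if (c \in paths S D) && (Var p \in S) then (x (c, Var p))%:~R else 0.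

Lemma mem_labels A c o : A \in S -> all [in S] c -> (size c <= D)%N ->
  (if o is Some B then B \in S else true) -> (A, c, o) \in labels.
Proof.
move=> AS cS sc oS; apply: allpairs_f.
  by apply: allpairs_f => //; apply: mem_paths.
by case: o oS => [B BS|//]; rewrite inE /= map_f.
Qed.

Lemma cm_val_bounded : exists2 r : R, 0 <= r & forall p c, - r <= cm_val p c <= r.
Proof.
pose L := [seq (c, f) | c <- paths S D, f <- S].
exists (\sum_(i <- L) `|x i|)%:~R; first by rewrite ler0z sumr_ge0.
move=> p c; rewrite -ler_norml /cm_val; case: ifP => [/andP[cD pS]|_]; last first.
  by rewrite normr0 ler0z sumr_ge0.
rewrite -intr_norm ler_int (big_rem (c, Var p)) /=; last exact: allpairs_f.
by rewrite lerDl sumr_ge0.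
Qed.

(** The depth budget keeps every node visited within [paths S D], where the constraints hold and
    [cm_val] is not cut off. *)
Lemma eval_cm a c : a \in S -> all [in S] c -> (mdepth a + size c <= D)%N ->
  eval cm_rel cm_val a c = (fev (node x c) a)%:~R.
Proof.
elim: a c => [p|a IHa b IHb|a IHa] c aS cS /= dD.
- by rewrite /cm_val aS mem_paths.
- have aS' := subs_trans aS.
  rewrite IHa ?IHb ?rmorphB //=; try by move: dD; lia.
  + by apply: aS'; rewrite /= inE mem_cat mem_subs !orbT.
  + by apply: aS'; rewrite /= inE mem_cat mem_subs !orbT.
- have aS1 : a \in S by apply: (subs_trans aS); rewrite /= inE mem_subs orbT.
  have scD : (size c <= D)%N by apply: leq_trans dD; apply: leq_addl.
  have ev A : A \in S -> eval cm_rel cm_val a (A :: c) = (fev (node x (A :: c)) a)%:~R.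
    by move=> AS; apply: IHa; rewrite //= ?AS // addnS.
  have lb A : A \in S -> x (c, Box a) <= fev (node x (A :: c)) a.
    move=> AS; have := xS (mem_labels (o := Some a) AS cS scD aS1).
    by rewrite /constr /= mul1r subr_ge0.
  (* The [None] label of the child [a :: c] gives the reverse inequality, so the infimum is attained
     there. *)
  have at_a : fev (node x (a :: c)) a = x (c, Box a).
    apply/eqP; rewrite eq_le lb // andbT.
    have := xS (mem_labels (o := None) aS1 cS scD isT).
    by rewrite /constr /= expr1 mulN1r opprB subr_ge0.
  rewrite (@inf_image_min _ _ _ (a :: c)); first by rewrite ev // at_a.
    by exists a.
  by move=> _ [A AS ->]; rewrite !ev // ler_int at_a lb.
Qed.

Lemma valid_fev_ge0 : KA_valid phi -> 0 <= fev (node x [::]) phi.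
Proof.
move=> vphi; have [r r0 rV] := cm_val_bounded.
have := vphi _ cm_rel cm_val r r0 rV [::].
by rewrite eval_cm ?mem_subs ?addn0 // ler0z.
Qed.

End Countermodel.

Lemma valid_GKAm phi : KA_valid phi -> GKAm [::] [:: phi].
Proof.
move=> vphi.
have [k [us [k0 _ cert]]] := farkas_int constr_linear (fev_node_linear phi [::])
  (fun x xS => valid_fev_ge0 xS vphi).
(* For [k = 1] this is already the goal; for larger [k], (sc_k) removes the multiplicity. *)
have := GKAm_certificate cert; case: k k0 {cert} => [|[|k]] // _ h.
apply: (@g_sc k.+2) => //.
have mrepE n (L : seq form) : mrep n.+1 L = L ++ mrep n L by [].
have -> : mrep k.+2 [::] = [::] by elim: k.+2 => // n IH; rewrite mrepE IH.
suff -> : mrep k.+2 [:: phi] = nseq k.+2 phi by [].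
by elim: k.+2 => // n IH; rewrite mrepE IH.
Qed.

Theorem theorem4p12 (phi : form) :
  (KA_valid phi <-> KAm phi) /\ (KAm phi <-> GKAm nil (phi :: nil)).
Proof.
by split; split; [move/valid_GKAm/GKAm_nil_KAm | exact: KAm_valid |
  move/KAm_valid/valid_GKAm | exact: GKAm_nil_KAm].
Qed.
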